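(* Let $K$ be a compact space whose topology is the order topology of a linear order on $K$, and assume $K$ is fragmentable. Then $K$ is almost totally disconnected.
   Context: A quasi metric on a set $K$ is a symmetric map $d:K\times K\to[0,+\infty)$ such that $d(x,y)=0$ iff $x=y$ (the triangle inequality is not required). A map $d:K\times K\to[0,+\infty)$ fragments a topological space $K$ if for every nonempty closed subset $L\subseteq K$ and every $\varepsilon>0$ there is a nonempty relatively open subset $U$ of $L$ with $\sup\{d(x,y):x,y\in U\}<\varepsilon$. A compact space $K$ is fragmentable if there exists a quasi metric on $K$ which fragments $K$. For a set $\Gamma$, $\Sigma_0^1[0,1]^\Gamma$ denotes the subspace of $[0,1]^\Gamma$ (product topology) consisting of those $x$ such that $x_\gamma\in\{0,1\}$ for all but countably many $\gamma\in\Gamma$. A compact space is almost totally disconnected if it is homeomorphic to a subspace of $\Sigma_0^1[0,1]^\Gamma$ for some set $\Gamma$. *)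

(* Defs.v *)
From Stdlib Require Import Reals List.
Open Scope R_scope.

(* A topology on X is represented by its family of open sets [op]. *)

Definition strict_linear_order {K : Type} (lt : K -> K -> Prop) : Prop :=
  (forall x, ~ lt x x) /\
  (forall x y z, lt x y -> lt y z -> lt x z) /\
  (forall x y, lt x y \/ x = y \/ lt y x).

Definition open_interval {K : Type} (lt : K -> K -> Prop) (a b : option K) (y : K) : Prop :=
  match a with Some a' => lt a' y | None => True end /\
  match b with Some b' => lt y b' | None => True end.

Definition order_open {K : Type} (lt : K -> K -> Prop) (U : K -> Prop) : Prop :=
  forall x, U x -> exists a b, open_interval lt a b x /\ (forall y, open_interval lt a b y -> U y).

Definition compact_space {X : Type} (op : (X -> Prop) -> Prop) : Prop :=
  forall (I : Type) (U : I -> X -> Prop),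
    (forall i, op (U i)) -> (forall x, exists i, U i x) ->
    exists l : list I, forall x, exists i, In i l /\ U i x.

Definition closed_set {X : Type} (op : (X -> Prop) -> Prop) (L : X -> Prop) : Prop :=
  op (fun x => ~ L x).

Definition quasi_metric {X : Type} (d : X -> X -> R) : Prop :=
  (forall x y, 0 <= d x y) /\ (forall x y, d x y = d y x) /\
  (forall x y, d x y = 0 <-> x = y).

Definition fragments {X : Type} (op : (X -> Prop) -> Prop) (d : X -> X -> R) : Prop :=
  forall (L : X -> Prop) (eps : R), closed_set op L -> (exists x, L x) -> 0 < eps ->
    exists U : X -> Prop, op U /\ (exists x, U x /\ L x) /\
      exists r, r < eps /\
        forall x y, U x -> L x -> U y -> L y -> d x y <= r.

Definition fragmentable {X : Type} (op : (X -> Prop) -> Prop) : Prop :=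
  exists d : X -> X -> R, quasi_metric d /\ fragments op d.

(* Product topology on R^Gamma (its subspace topology on [0,1]^Gamma is the
   product topology of [0,1]^Gamma). *)
Definition product_open {G : Type} (V : (G -> R) -> Prop) : Prop :=
  forall x, V x -> exists (l : list G) (eps : R), 0 < eps /\
    forall y, (forall g, In g l -> Rabs (y g - x g) < eps) -> V y.

Definition countable_set {G : Type} (S : G -> Prop) : Prop :=
  exists h : G -> nat, forall g1 g2, S g1 -> S g2 -> h g1 = h g2 -> g1 = g2.

Definition in_Sigma {G : Type} (x : G -> R) : Prop :=
  (forall g, 0 <= x g <= 1) /\ countable_set (fun g => x g <> 0 /\ x g <> 1).

Definition almost_totally_disconnected {X : Type} (op : (X -> Prop) -> Prop) : Prop :=
  exists (G : Type) (f : X -> (G -> R)),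
    (forall x, in_Sigma (f x)) /\
    (forall x y, f x = f y -> x = y) /\
    (forall V, product_open V -> op (fun x => V (f x))) /\
    (forall U, op U -> exists V, product_open V /\ forall x, U x <-> V (f x)).

(* Main.v *)
From Stdlib Require Import Reals List Lra Lia Arith.
From Stdlib Require Import Classical ClassicalEpsilon ProofIrrelevance FunctionalExtensionality.
From mathcomp Require classical_sets.
Require Import Defs.
Set Bullet Behavior "Strict Subproofs".

(** A jump [p < q] of [K] gives the continuous two-valued function "[q <= x]". For each [n]
    take, by Zorn's lemma, a maximal family [F n] of continuous [phi : K -> [0,1]] such that
    [phi] is [0] below some [a] and [1] above some [b] with [(a, b)] of [d]-diameter less than
    [1/(n+1)], no two of them taking a value in [(0, 1)] at the same point. At each point at
    most one member of each [F n] is not two-valued, so it remains to separate points.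

    Let [x < y] with no jump in between; choose [x < u < u' < v < v' < y] and [n] with
    [1/(n+1)] below [d u u'] and [d v v']. Fragmentability gives a subinterval of [(u', v)] of
    [d]-diameter less than [1/(n+1)], hence by maximality a member of [F n] whose interval
    [(a, b)] meets [(u', v)]. If [a < x] then [u] and [u'] lie in [(a, b)], and if [y < b] then
    [v] and [v'] do; both contradict the choice of [n]. So [x <= a < b <= y] and the function
    separates [x] from [y]. *)

(** * Maximal families by Zorn's lemma *)

(** Two members of the union of a chain already lie in one link of it, so Zorn's lemma applies; if
    [t] were compatible with all of [F], adding it would contradict maximality. [C] is asked of
    distinct members only, since a function with a value in (0, 1) will not be compatible with
    itself. *)
Lemma maximal_compatible_family (T : Type) (A : T -> Prop) (C : T -> T -> Prop) :
  (forall s t, C s t -> C t s) ->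
  exists F : T -> Prop,
    (forall t, F t -> A t) /\
    (forall s t, F s -> F t -> s <> t -> C s t) /\
    (forall t, A t -> F t \/ exists s, F s /\ ~ C s t).
Proof.
  intros Csym.
  destruct (@classical_sets.Zorn_bigcup T (fun F => (forall t, F t -> A t) /\
      forall s t, F s -> F t -> s <> t -> C s t)) as [F [[FA FC] Fmax]].
  - intros S HS Htot. split.
    + intros t [X SX Xt]. exact (proj1 (HS X SX) t Xt).
    + intros s t [X SX Xs] [Y SY Yt] Hst.
      destruct (Htot X Y SX SY) as [XY | YX].
      * exact (proj2 (HS Y SY) s t (XY s Xs) Yt Hst).
      * exact (proj2 (HS X SX) s t Xs (YX t Yt) Hst).
  - exists F. split; [exact FA | split; [exact FC |]].
    intros t At. destruct (classic (F t)) as [Ft | nFt]; [now left | right].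
    apply NNPP. intros Hno. apply (Fmax (fun s => F s \/ s = t)).
    + split.
      * intros s Fs. now left.
      * intros Hsub. apply nFt, Hsub. now right.
    + assert (Ct : forall s, F s -> C s t).
      { intros s Fs. apply NNPP. intros nC. apply Hno. now exists s. }
      split.
      * intros s [Fs | ->]; auto.
      * intros s s' [Fs | ->] [Fs' | ->] Hne; auto. now destruct Hne.
Qed.

(** * Continuity and intervals in a linear order *)

Definition continuous_order {K : Type} (lt : K -> K -> Prop) (f : K -> R) : Prop :=
  forall x eps, 0 < eps ->
    exists a b, open_interval lt a b x /\
      forall y, open_interval lt a b y -> Rabs (f y - f x) < eps.

(** [x <= y] is written [~ lt y x]. *)

Section LinearOrder.

Variables (K : Type) (lt : K -> K -> Prop).
Hypothesis Hlin : strict_linear_order lt.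

Lemma lt_irr x : ~ lt x x.
Proof. apply Hlin. Qed.

Lemma lt_tr x y z : lt x y -> lt y z -> lt x z.
Proof. apply Hlin. Qed.

Lemma lt_le x y : lt x y -> ~ lt y x.
Proof. intros H1 H2. exact (lt_irr x (lt_tr _ _ _ H1 H2)). Qed.

Lemma lt_le_tr x y z : lt x y -> ~ lt z y -> lt x z.
Proof.
  intros H1 H2. destruct (proj2 (proj2 Hlin) y z) as [H | [<- | H]]; auto.
  - exact (lt_tr _ _ _ H1 H).
  - contradiction.
Qed.

Lemma le_lt_tr x y z : ~ lt y x -> lt y z -> lt x z.
Proof.
  intros H1 H2. destruct (proj2 (proj2 Hlin) x y) as [H | [-> | H]]; auto.
  - exact (lt_tr _ _ _ H H2).
  - contradiction.
Qed.

Lemma le_tr x y z : ~ lt y x -> ~ lt z y -> ~ lt z x.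
Proof. intros H1 H2 H. exact (H2 (lt_le_tr _ _ _ H H1)). Qed.

Lemma open_interval_inter a b a' b' x :
  open_interval lt a b x -> open_interval lt a' b' x ->
  exists a'' b'', open_interval lt a'' b'' x /\
    forall y, open_interval lt a'' b'' y -> open_interval lt a b y /\ open_interval lt a' b' y.
Proof.
  intros [Ha Hb] [Ha' Hb'].
  assert (L : exists a'', match a'' with Some c => lt c x | None => True end /\
    forall y, match a'' with Some c => lt c y | None => True end ->
      match a with Some c => lt c y | None => True end /\
      match a' with Some c => lt c y | None => True end).
  { destruct a as [a |]; [| exists a'; auto].
    destruct a' as [a' |]; [| exists (Some a); auto].
    destruct (classic (lt a a')) as [H | H].
    - exists (Some a'). split; auto. intros y Hy. split; auto. exact (lt_tr _ _ _ H Hy).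
    - exists (Some a). split; auto. intros y Hy. split; auto. exact (le_lt_tr _ _ _ H Hy). }
  assert (M : exists b'', match b'' with Some c => lt x c | None => True end /\
    forall y, match b'' with Some c => lt y c | None => True end ->
      match b with Some c => lt y c | None => True end /\
      match b' with Some c => lt y c | None => True end).
  { destruct b as [b |]; [| exists b'; auto].
    destruct b' as [b' |]; [| exists (Some b); auto].
    destruct (classic (lt b b')) as [H | H].
    - exists (Some b). split; auto. intros y Hy. split; auto. exact (lt_tr _ _ _ Hy H).
    - exists (Some b'). split; auto. intros y Hy. split; auto. exact (lt_le_tr _ _ _ Hy H). }
  destruct L as [a'' [L1 L2]], M as [b'' [M1 M2]].
  exists a'', b''. split; [now split |].
  intros y [Ya Yb]. specialize (L2 y Ya). specialize (M2 y Yb).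
  unfold open_interval. tauto.
Qed.

(** Density in the sense of order: the segment [s, t] contains no jump. *)
Definition dense_between (s t : K) : Prop :=
  forall u v, ~ lt u s -> ~ lt t v -> lt u v -> exists w, lt u w /\ lt w v.

Lemma dense_between_sub s t p q :
  dense_between s t -> ~ lt p s -> ~ lt t q -> dense_between p q.
Proof. intros D Hp Hq u v Hu Hv. apply D; eauto using le_tr. Qed.

(** ** Urysohn functions *)

(* [dyadic_point n k] stands for the point at height [k / 2^n]; it is meaningful for
   [k <= 2^n] only. *)
Fixpoint dyadic_point (mid : K -> K -> K) (a b : K) (n k : nat) : K :=
  match n with
  | O => match k with O => a | _ => b end
  | S n' => let h := Nat.div2 k in
            if Nat.even k then dyadic_point mid a b n' h
            else mid (dyadic_point mid a b n' h) (dyadic_point mid a b n' (S h))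
  end.

Section Dyadic.

Variables (mid : K -> K -> K) (a b : K).
Hypothesis ab : lt a b.
Hypothesis Hmid : forall u v, ~ lt u a -> ~ lt b v -> lt u v -> lt u (mid u v) /\ lt (mid u v) v.

Let g := dyadic_point mid a b.

Lemma dyadic_even n k : g (S n) (2 * k) = g n k.
Proof.
  unfold g. cbn [dyadic_point]. rewrite Nat.even_mul, Nat.div2_double. reflexivity.
Qed.

Lemma dyadic_odd n k : g (S n) (S (2 * k)) = mid (g n k) (g n (S k)).
Proof.
  unfold g. cbn [dyadic_point].
  rewrite Nat.even_succ, Nat.odd_mul, Nat.div2_succ_double. reflexivity.
Qed.

(** Each level keeps the points of the previous one, so points of different levels can be compared
    at a common level. *)
Lemma dyadic_scale n m k : g (m + n) (2 ^ m * k) = g n k.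
Proof.
  induction m as [| m IH].
  - f_equal. simpl. lia.
  - now rewrite Nat.pow_succ_r', <- Nat.mul_assoc, <- IH, <- (dyadic_even (m + n)).
Qed.

(** Both halves go through one induction, because [Hmid] applies only to an increasing pair inside
    [a, b]. *)
Lemma dyadic_bounds_step n :
  (forall k, (k <= 2 ^ n)%nat -> ~ lt (g n k) a /\ ~ lt b (g n k)) /\
  (forall k, (k < 2 ^ n)%nat -> lt (g n k) (g n (S k))).
Proof.
  induction n as [| n [B S1]].
  - split.
    + intros [| k] _; cbn; split; auto using lt_irr, lt_le.
    + intros [| k] Hk; cbn in *; [exact ab | lia].
  - rewrite Nat.pow_succ_r'.
    assert (Hm : forall k, (k < 2 ^ n)%nat ->
      lt (g n k) (g (S n) (S (2 * k))) /\ lt (g (S n) (S (2 * k))) (g n (S k))).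
    { intros k Hk. rewrite dyadic_odd. apply Hmid; [apply B; lia | apply B; lia | auto]. }
    split; intros k Hk; destruct (Nat.Even_or_Odd k) as [[j ->] | [j ->]].
    + rewrite dyadic_even. apply B. lia.
    + rewrite Nat.add_1_r in *. destruct (Hm j) as [H1 H2]; [lia |].
      split; apply lt_le.
      * apply le_lt_tr with (g n j); auto. apply B. lia.
      * apply lt_le_tr with (g n (S j)); auto. apply B. lia.
    + rewrite dyadic_even. apply Hm. lia.
    + rewrite Nat.add_1_r in *. replace (S (S (2 * j))) with (2 * S j)%nat by lia.
      rewrite dyadic_even. apply Hm. lia.
Qed.

Lemma dyadic_lt n j k : (j < k)%nat -> (k <= 2 ^ n)%nat -> lt (g n j) (g n k).
Proof.
  intros Hjk. induction Hjk as [| k Hjk IH]; intros Hk.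
  - now apply dyadic_bounds_step.
  - apply lt_tr with (g n k); [apply IH; lia | now apply dyadic_bounds_step].
Qed.

(** The heights of the dyadic points up to [x], whose supremum will be the Urysohn function. The
    disjunct [r = 0] keeps the set nonempty when [x] lies below [a]. *)
Let below (x : K) (r : R) : Prop :=
  r = 0 \/ exists n k, (k <= 2 ^ n)%nat /\ ~ lt x (g n k) /\ r = INR k / 2 ^ n.

Lemma pow2_pos n : 0 < 2 ^ n.
Proof. apply pow_lt. lra. Qed.

Lemma INR_pow2 n : INR (2 ^ n) = 2 ^ n.
Proof. rewrite pow_INR. reflexivity. Qed.

Lemma dyadic_height_le n k : (k <= 2 ^ n)%nat -> 0 <= INR k / 2 ^ n <= 1.
Proof.
  intros Hk. pose proof (pow2_pos n). apply le_INR in Hk. rewrite INR_pow2 in Hk.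
  pose proof (pos_INR k). split.
  - apply Rmult_le_pos; [lra | left; now apply Rinv_0_lt_compat].
  - apply Rmult_le_reg_r with (2 ^ n); auto. field_simplify; lra.
Qed.

Lemma below_lub x : {f | is_lub (below x) f}.
Proof.
  apply completeness.
  - exists 1. intros r [-> | (n & k & Hk & _ & ->)]; [lra | now apply dyadic_height_le].
  - exists 0. now left.
Qed.

(** A greater height j / 2^m would put [g m j] above [g n k], as seen at the common level [n + m],
    hence above [x]. *)
Lemma below_dyadic x n k r :
  (k <= 2 ^ n)%nat -> lt x (g n k) -> below x r -> r <= INR k / 2 ^ n.
Proof.
  intros Hk Hx [-> | (m & j & Hj & Hy & ->)]; [now apply dyadic_height_le |].
  apply Rnot_lt_le. intros Hlt.
  assert (H : (2 ^ m * k < 2 ^ n * j)%nat).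
  { apply INR_lt. rewrite !mult_INR, !INR_pow2.
    pose proof (pow2_pos n) as Pn. pose proof (pow2_pos m) as Pm.
    apply Rmult_lt_compat_r with (r := 2 ^ n * 2 ^ m) in Hlt; [| now apply Rmult_lt_0_compat].
    field_simplify in Hlt; lra. }
  apply Hy. apply lt_tr with (g n k); auto.
  rewrite <- (dyadic_scale n m k), <- (dyadic_scale m n j), (Nat.add_comm n m).
  apply dyadic_lt; auto. rewrite Nat.pow_add_r, Nat.mul_comm. nia.
Qed.

(** Locates [x] in the grid of level [n]. Points below [a] get [k = O], and points from [b] on get
    [k = 2 ^ n], where no next grid point is available. *)
Lemma dyadic_floor x n : exists k, (k <= 2 ^ n)%nat /\
  (k = O \/ ~ lt x (g n k)) /\ (k = (2 ^ n)%nat \/ (k < 2 ^ n)%nat /\ lt x (g n (S k))).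
Proof.
  assert (H : forall m, (m <= 2 ^ n)%nat -> exists k, (k <= m)%nat /\
    (k = O \/ ~ lt x (g n k)) /\ (k = m \/ (k < m)%nat /\ lt x (g n (S k)))).
  { induction m as [| m IH]; intros Hm.
    - exists O. auto.
    - destruct (classic (lt x (g n (S m)))) as [Hx | Hx].
      + destruct IH as (k & H1 & H2 & H3); [lia |]. exists k.
        split; [lia | split; [exact H2 | right]].
        destruct H3 as [-> | [H3 H4]]; split; auto; lia.
      + exists (S m). auto. }
  now apply H.
Qed.

Lemma urysohn_dyadic : exists f : K -> R,
  continuous_order lt f /\ (forall x, 0 <= f x <= 1) /\
  (forall x, ~ lt a x -> f x = 0) /\ (forall x, ~ lt x b -> f x = 1).
Proof.
  set (f x := proj1_sig (below_lub x)).
  assert (Hf : forall x, is_lub (below x) (f x)) by (intros x; exact (proj2_sig (below_lub x))).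
  assert (f01 : forall x, 0 <= f x <= 1).
  { intros x. split; [apply (Hf x); now left |]. apply (Hf x).
    intros r [-> | (n & k & Hk & _ & ->)]; [lra | now apply dyadic_height_le]. }
  assert (flo : forall x n k, (k <= 2 ^ n)%nat -> ~ lt x (g n k) -> INR k / 2 ^ n <= f x).
  { intros x n k Hk Hx. apply (Hf x). right. now exists n, k. }
  assert (fhi : forall x n k, (k <= 2 ^ n)%nat -> lt x (g n k) -> f x <= INR k / 2 ^ n).
  { intros x n k Hk Hx. apply (Hf x). intros r. now apply below_dyadic. }
  exists f. split; [| split; [exact f01 | split]].
  - intros x eps Heps.
    (* Near [x] all values will lie between (k - 1) / 2^n and (k + 1) / 2^n, an interval of length 2
       / 2^n; hence [eps / 2]. *)
    destruct (pow_lt_1_zero (1 / 2)) with (y := eps / 2) as [n Hn];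
      [rewrite Rabs_pos_eq; lra | lra |].
    specialize (Hn n (le_n n)).
    assert (E : (1 / 2) ^ n = / 2 ^ n).
    { unfold Rdiv. rewrite Rmult_1_l. apply pow_inv. }
    pose proof (pow2_pos n) as Pn. pose proof (Rinv_0_lt_compat _ Pn) as Pi.
    rewrite E, Rabs_pos_eq in Hn by lra.
    destruct (dyadic_floor x n) as (k & Hk & Hlo & Hhi).
    (* The left endpoint is one grid step below the floor of [x], as [x] may itself be a grid
       point. *)
    assert (Lo : exists c, match c with Some c => lt c x | None => True end /\
      forall y, match c with Some c => lt c y | None => True end ->
        INR k / 2 ^ n - / 2 ^ n <= f y).
    { destruct k as [| k].
      - exists None. split; auto. intros y _. pose proof (f01 y). simpl. lra.
      - destruct Hlo as [Hlo | Hlo]; [discriminate |].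
        exists (Some (g n k)). split.
        + apply lt_le_tr with (g n (S k)); auto. apply dyadic_lt; lia.
        + intros y Hy. apply Rle_trans with (INR k / 2 ^ n).
          * rewrite S_INR. right. field. lra.
          * apply flo; [lia | now apply lt_le]. }
    assert (Hi : exists c, match c with Some c => lt x c | None => True end /\
      forall y, match c with Some c => lt y c | None => True end ->
        f y <= INR k / 2 ^ n + / 2 ^ n).
    { destruct Hhi as [-> | [Hk' Hhi]].
      - exists None. split; auto. intros y _. pose proof (f01 y).
        rewrite INR_pow2. unfold Rdiv. rewrite Rinv_r; lra.
      - exists (Some (g n (S k))). split; auto.
        intros y Hy. apply Rle_trans with (INR (S k) / 2 ^ n).
        * apply fhi; [lia | auto].
        * rewrite S_INR. right. field. lra. }
    assert (Fx : INR k / 2 ^ n <= f x).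
    { destruct Hlo as [-> | Hlo]; [| now apply flo].
      pose proof (f01 x). simpl. lra. }
    destruct Lo as (c & c1 & c2), Hi as (e & e1 & e2).
    exists c, e. split; [now split |].
    intros y [Yc Ye]. specialize (c2 y Yc). pose proof (e2 x e1). specialize (e2 y Ye).
    apply Rabs_def1; lra.
  (* If [f x] were positive, some 1 / 2^n would be smaller; but [x] is at most [a], which is [g n 0]
     and lies below [g n 1], so [f x] is at most 1 / 2^n. *)
  - intros x Hx. apply Rle_antisym; [| apply f01]. apply Rnot_lt_le. intros H.
    destruct (pow_lt_1_zero (1 / 2)) with (y := f x) as [n Hn];
      [rewrite Rabs_pos_eq; lra | lra |].
    specialize (Hn n (le_n n)).
    assert (E : (1 / 2) ^ n = INR 1 / 2 ^ n).
    { unfold Rdiv. rewrite Rmult_1_l. simpl INR. rewrite Rmult_1_l. apply pow_inv. }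
    assert (H1 : (1 <= 2 ^ n)%nat) by (pose proof (Nat.pow_nonzero 2 n); lia).
    rewrite E, Rabs_pos_eq in Hn by now apply dyadic_height_le.
    apply Rlt_not_le in Hn. apply Hn. apply fhi; auto.
    apply le_lt_tr with (g n 0); [| apply dyadic_lt; auto].
    replace (g n 0) with a; auto.
    change a with (g 0 0). rewrite <- (dyadic_scale 0 n 0), Nat.add_0_r, Nat.mul_0_r. reflexivity.
  - intros x Hx. apply Rle_antisym; [apply f01 |].
    replace 1 with (INR 1 / 2 ^ 0) by (simpl; field). apply flo; auto.
Qed.

End Dyadic.

Lemma urysohn_dense a b :
  lt a b -> dense_between a b ->
  exists f : K -> R, continuous_order lt f /\ (forall x, 0 <= f x <= 1) /\
    (forall x, ~ lt a x -> f x = 0) /\ (forall x, ~ lt x b -> f x = 1).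
Proof.
  intros ab D.
  (* The arbitrary value of [epsilon] on pairs with nothing in between is harmless: [Hmid] concerns
     only pairs in [a, b], where density provides a witness. *)
  apply (urysohn_dyadic (fun u v => epsilon (inhabits a) (fun w => lt u w /\ lt w v)) a b ab).
  intros u v Hu Hv Huv. apply (epsilon_spec (inhabits a) (fun w => lt u w /\ lt w v)).
  now apply D.
Qed.

(** Across a jump, the ray from [q] on equals the open ray above [p], so the indicator of this
    clopen set is continuous. *)
Lemma jump_indicator p q :
  lt p q -> (forall w, ~ (lt p w /\ lt w q)) ->
  exists f : K -> R, continuous_order lt f /\ (forall x, f x = 0 \/ f x = 1) /\
    (forall x, ~ lt p x -> f x = 0) /\ (forall x, ~ lt x q -> f x = 1).
Proof.
  intros pq J.
  exists (fun x => if excluded_middle_informative (lt x q) then 0 else 1).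
  split; [| split; [| split]].
  - intros x eps Heps. destruct (excluded_middle_informative (lt x q)) as [H | H].
    + exists None, (Some q). split; [now split |]. intros y [_ Hy].
      destruct (excluded_middle_informative (lt y q)); [| contradiction].
      rewrite Rminus_diag, Rabs_R0. exact Heps.
    + exists (Some p), None. split; [split; auto; now apply lt_le_tr with q |].
      intros y [Hy _].
      destruct (excluded_middle_informative (lt y q)); [exfalso; now apply (J y) |].
      rewrite Rminus_diag, Rabs_R0. exact Heps.
  - intros x. destruct (excluded_middle_informative (lt x q)); auto.
  - intros x Hx. destruct (excluded_middle_informative (lt x q)) as [H | H]; auto.
    destruct H. now apply le_lt_tr with p.
  - intros x Hx. destruct (excluded_middle_informative (lt x q)); [contradiction | auto].
Qed.

(** ** Fragmentability *)

Lemma fragments_small_interval (d : K -> K -> R) s t eps :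
  fragments (order_open lt) d -> lt s t -> dense_between s t -> 0 < eps ->
  exists p q, ~ lt p s /\ ~ lt t q /\ lt p q /\
    forall x y, lt p x -> lt x q -> lt p y -> lt y q -> d x y < eps.
Proof.
  intros Hfr st D Heps.
  destruct (Hfr (fun x => ~ lt x s /\ ~ lt t x) eps)
    as (U & HU & (z & Uz & Lz1 & Lz2) & r & Hr & Hd); auto.
  - intros x Hx. apply not_and_or in Hx. destruct Hx as [Hx | Hx]; apply NNPP in Hx.
    + exists None, (Some s). split; [now split |]. intros y [_ Hy] [Hs _]. auto.
    + exists (Some t), None. split; [now split |]. intros y [Hy _] [_ Ht]. auto.
  - exists s. split; auto using lt_irr, lt_le.
  - destruct (HU z Uz) as (a & b & [Ha Hb] & Hab).
    assert (E : exists p q, ~ lt p s /\ ~ lt t q /\ lt p q /\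
      forall x, lt p x -> lt x q -> open_interval lt a b x).
    (* The point [z] may be an end of [s, t]. If [z < t], take the part of the neighbourhood to the
       right of [z], cut off at [t]; otherwise the part to the left, cut off at [s]. *)
    { destruct (classic (lt z t)) as [zt | zt].
      - assert (Lower : forall x, lt z x -> match a with Some a' => lt a' x | None => True end).
        { intros x Hx. destruct a; auto. now apply lt_tr with z. }
        destruct b as [b |].
        + destruct (classic (lt b t)) as [bt | bt].
          * exists z, b. repeat split; first [now apply lt_le | now apply Lower | auto].
          * exists z, t. repeat split; first [now apply lt_irr | now apply Lower | auto].
            now apply lt_le_tr with t.
        + exists z, t. repeat split; first [now apply lt_irr | now apply Lower | auto].
      - assert (sz : lt s z) by now apply lt_le_tr with t.
        assert (Upper : forall x, lt x z -> match b with Some b' => lt x b' | None => True end).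
        { intros x Hx. destruct b; auto. now apply lt_tr with z. }
        destruct a as [a |].
        + destruct (classic (lt s a)) as [sa | sa].
          * exists a, z. repeat split; first [now apply lt_le | now apply Upper | auto].
          * exists s, z. repeat split; first [now apply lt_irr | now apply Upper | auto].
            now apply le_lt_tr with s.
        + exists s, z. repeat split; first [now apply lt_irr | now apply Upper | auto]. }
    destruct E as (p & q & ps & qt & pq & Hpq).
    exists p, q. split; auto. split; auto. split; auto.
    assert (HL : forall x, lt p x -> lt x q -> ~ lt x s /\ ~ lt t x).
    { intros x px xq. split; apply lt_le.
      - now apply le_lt_tr with p.
      - now apply lt_le_tr with q. }
    intros x y px xq py yq.
    apply Rle_lt_trans with r; [apply Hd |]; auto.
Qed.

(** The inequality [a < b] is automatic, since otherwise [f a] would be both 0 and 1. *)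
Definition small_step (d : K -> K -> R) (eps : R) (f : K -> R) : Prop :=
  continuous_order lt f /\ (forall x, 0 <= f x <= 1) /\
  exists a b, (forall x, ~ lt a x -> f x = 0) /\ (forall x, ~ lt x b -> f x = 1) /\
    forall x y, lt a x -> lt x b -> lt a y -> lt y b -> d x y < eps.

Definition in_between (r : R) : Prop := r <> 0 /\ r <> 1.

Lemma maximal_family_separates (d : K -> K -> R) eps (F : (K -> R) -> Prop) x u u' v v' y :
  fragments (order_open lt) d -> 0 < eps ->
  (forall f, F f -> small_step d eps f) ->
  (forall f, small_step d eps f ->
    F f \/ exists f', F f' /\ ~ (forall z, ~ (in_between (f' z) /\ in_between (f z)))) ->
  dense_between x y ->
  lt x u -> lt u u' -> lt u' v -> lt v v' -> lt v' y ->
  eps <= d u u' -> eps <= d v v' ->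
  exists f, F f /\ f x <> f y.
Proof.
  intros Hfr Heps FS Fmax D xu uu' u'v vv' v'y du dv.
  assert (xu' : lt x u') by eauto using lt_tr.
  assert (vy : lt v y) by eauto using lt_tr.
  destruct (fragments_small_interval d u' v eps) as (p & q & pu & qv & pq & Hpq); auto.
  { apply dense_between_sub with x y; auto using lt_le. }
  assert (xp : lt x p) by (now apply lt_le_tr with u').
  assert (qy : lt q y) by (now apply le_lt_tr with v).
  destruct (urysohn_dense p q pq) as (f & fc & f01 & f0 & f1).
  { apply dense_between_sub with x y; auto using lt_le. }
  assert (Sf : small_step d eps f) by (split; auto; split; auto; now exists p, q).
  destruct (Fmax f Sf) as [Ff | (h & Fh & Hh)].
  - exists f. split; auto. rewrite f0, f1 by auto using lt_le. lra.
  - apply not_all_not_ex in Hh. destruct Hh as [z [[hz0 hz1] [fz0 fz1]]].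
    destruct (FS h Fh) as (_ & _ & a & b & h0 & h1 & Hab).
    (* Each function is two-valued off its interval, so [z] lies in both (p, q) and (a, b). *)
    assert (pz : lt p z) by (apply NNPP; auto).
    assert (zq : lt z q) by (apply NNPP; auto).
    assert (az : lt a z) by (apply NNPP; auto).
    assert (zb : lt z b) by (apply NNPP; auto).
    assert (u'z : lt u' z) by (now apply le_lt_tr with p).
    assert (zv : lt z v) by (now apply lt_le_tr with q).
    exists h. split; auto. rewrite h0, h1; [lra | |].
    (* Here a < z < v < v' < y < b; the other case is the mirror image with [u] and [u']. *)
    + intros yb. apply (Rlt_not_le _ _ (Hab v v' ltac:(eauto using lt_tr) ltac:(eauto using lt_tr)
        ltac:(eauto using lt_tr) ltac:(eauto using lt_tr))); exact dv.
    + intros ax. apply (Rlt_not_le _ _ (Hab u u' ltac:(eauto using lt_tr) ltac:(eauto using lt_tr)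
        ltac:(eauto using lt_tr) ltac:(eauto using lt_tr))); exact du.
Qed.

Lemma dense_between_four x y :
  lt x y -> dense_between x y ->
  exists u u' v v', lt x u /\ lt u u' /\ lt u' v /\ lt v v' /\ lt v' y.
Proof.
  intros xy D.
  assert (step : forall s, ~ lt s x -> lt s y -> exists w, lt s w /\ lt w y /\ ~ lt w x).
  { intros s xs sy. destruct (D s y xs (lt_irr y) sy) as (w & sw & wy).
    exists w. split; auto. split; auto. apply lt_le. now apply le_lt_tr with s. }
  destruct (step x) as (u & ? & ? & ?); auto using lt_irr.
  destruct (step u) as (u' & ? & ? & ?); auto.
  destruct (step u') as (v & ? & ? & ?); auto.
  destruct (step v) as (v' & ? & ? & ?); auto.
  now exists u, u', v, v'.
Qed.

Lemma not_dense_jump x y :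
  ~ dense_between x y ->
  exists p q, ~ lt p x /\ ~ lt y q /\ lt p q /\ forall w, ~ (lt p w /\ lt w q).
Proof.
  intros nD. apply NNPP. intros H. apply nD. intros p q xp qy pq. apply NNPP. intros Hw.
  apply H. exists p, q. repeat split; auto. intros w Hpq. apply Hw. now exists w.
Qed.

(** ** Embedding *)

Lemma continuous_coordinates_open (G : Type) (f : K -> G -> R) :
  (forall g, continuous_order lt (fun x => f x g)) ->
  forall V, product_open V -> order_open lt (fun x => V (f x)).
Proof.
  intros Hc V HV x Vx. destruct (HV _ Vx) as (l & eps & Heps & Hl).
  assert (H : exists a b, open_interval lt a b x /\
    forall y, open_interval lt a b y -> forall g, In g l -> Rabs (f y g - f x g) < eps).
  { clear Hl. induction l as [| g l (a & b & Hx & Hy)].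
    - exists None, None. split; [now split | intros y _ g []].
    - destruct (Hc g x eps Heps) as (a' & b' & Hx' & Hy').
      destruct (open_interval_inter _ _ _ _ _ Hx Hx') as (a'' & b'' & Hx'' & Hy'').
      exists a'', b''. split; auto. intros y Y. destruct (Hy'' y Y) as [Y1 Y2].
      intros h [<- | Hh]; [now apply Hy' | now apply Hy]. }
  destruct H as (a & b & Hx & Hy). exists a, b. auto.
Qed.

(** Turns a finite subcover into a basic neighbourhood in the product. Entries [None] stand for a
    set that imposes no condition, and nonpositive radii, which index empty sets of the cover, are
    skipped. *)
Lemma finite_coordinate_bound (G : Type) (l : list (option (G * R))) :
  exists (lg : list G) (eps : R), 0 < eps /\
    forall g e, In (Some (g, e)) l -> 0 < e -> In g lg /\ eps <= e.
Proof.
  induction l as [| [[g e] |] l (lg & eps & Heps & H)].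
  - exists nil, 1. split; [lra | intros g e []].
  - destruct (Rlt_le_dec 0 e) as [He | He].
    + exists (g :: lg), (Rmin e eps). split; [now apply Rmin_glb_lt |].
      intros g' e' [E | E] He'.
      * injection E as -> ->. split; [now left | apply Rmin_l].
      * destruct (H g' e' E He'). split; [now right | eapply Rle_trans; [apply Rmin_r | auto]].
    + exists lg, eps. split; auto. intros g' e' [E | E] He'; [injection E as -> ->; lra | auto].
  - exists lg, eps. split; auto. intros g' e' [E | E] He'; [discriminate | auto].
Qed.

(** A continuous injection of a compact space into a Hausdorff space is an embedding: [V] is the
    complement of the image of the complement of [U]. For [z] in [V], the space is covered by [U]
    and the open sets of points whose image is farther than [e] from [z] in coordinate [g]. *)
Lemma compact_embedding (G : Type) (f : K -> G -> R) :
  compact_space (order_open lt) ->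
  (forall g, continuous_order lt (fun x => f x g)) ->
  (forall x y, f x = f y -> x = y) ->
  forall U, order_open lt U -> exists V, product_open V /\ forall x, U x <-> V (f x).
Proof.
  intros Hcomp Hc Hinj U HU.
  exists (fun z => forall x, f x = z -> U x). split.
  - intros z Hz.
    set (W (i : option (G * R)) (y : K) := match i with
      | None => U y
      | Some (g, e) => 0 < e /\ e < Rabs (f y g - z g) end).
    destruct (Hcomp _ W) as [l Hl].
    + intros [[g e] |]; [| exact HU]. intros y [He Hy].
      destruct (Hc g y (Rabs (f y g - z g) - e)) as (a & b & Hab & Hy'); [lra |].
      exists a, b. split; auto. intros y' Y. specialize (Hy' y' Y). split; auto.
      pose proof (Rabs_triang_inv (f y g - z g) (f y g - f y' g)) as T.
      rewrite (Rabs_minus_sym (f y g) (f y' g)) in T.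
      replace (f y g - z g - (f y g - f y' g)) with (f y' g - z g) in T by ring. lra.
    + intros x. destruct (classic (U x)) as [Ux | nUx]; [now exists None |].
      destruct (classic (exists g, f x g <> z g)) as [[g Hg] | Hg].
      * exists (Some (g, Rabs (f x g - z g) / 2)). simpl.
        assert (0 < Rabs (f x g - z g)) by (apply Rabs_pos_lt; lra). lra.
      * destruct nUx. apply Hz. extensionality g. apply NNPP. intros H. apply Hg. now exists g.
    + destruct (finite_coordinate_bound G l) as (lg & eps & Heps & H).
      (* If the image of [x] is close to [z] in the coordinates of the subcover, only [U] can
         contain [x]. *)
      exists lg, eps. split; auto. intros z' Hz' x <-.
      destruct (Hl x) as ([[g e] |] & Hi & Hx); auto.
      destruct Hx as [He Hx]. destruct (H g e Hi He) as [Hg Hle].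
      specialize (Hz' g Hg). lra.
  - intros x. split.
    + intros Ux y E. apply Hinj in E. now subst.
    + auto.
Qed.

(** The coordinates are all continuous two-valued functions and all members of the families. At a
    given point each [F n] has at most one value off 0 and 1, so [n] numbers the exceptional
    coordinates. *)
Lemma disjoint_families_embed (F : nat -> (K -> R) -> Prop) :
  compact_space (order_open lt) ->
  (forall n f, F n f -> continuous_order lt f /\ forall x, 0 <= f x <= 1) ->
  (forall n f h x, F n f -> F n h -> in_between (f x) -> in_between (h x) -> f = h) ->
  (forall x y, lt x y -> exists f, f x <> f y /\
     (continuous_order lt f /\ (forall z, f z = 0 \/ f z = 1) \/ exists n, F n f)) ->
  almost_totally_disconnected (order_open lt).
Proof.
  intros Hcomp Fc Fd Fs.
  set (P f := continuous_order lt f /\ (forall z, f z = 0 \/ f z = 1) \/ exists n, F n f).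
  set (e (x : K) (g : {f | P f}) := proj1_sig g x).
  assert (ec : forall g, continuous_order lt (fun x => e x g)).
  { intros [f Pf]. change (continuous_order lt f).
    destruct Pf as [[Hf _] | [n Hf]]; [exact Hf | exact (proj1 (Fc n f Hf))]. }
  assert (einj : forall x y, e x = e y -> x = y).
  { assert (Hlt : forall x y, lt x y -> e x <> e y).
    { intros x y xy E. destruct (Fs x y xy) as (f & Hf & Pf).
      apply Hf. exact (f_equal (fun z => z (exist P f Pf)) E). }
    intros x y E. destruct (proj2 (proj2 Hlin) x y) as [xy | [xy | xy]]; auto.
    - now destruct (Hlt x y xy).
    - now destruct (Hlt y x xy). }
  exists {f | P f}, e. split; [| split; [exact einj | split]].
  - intros x. split.
    + intros [f Pf]. change (0 <= f x <= 1). destruct Pf as [[_ Hf] | [n Hf]].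
      * destruct (Hf x) as [-> | ->]; lra.
      * apply (Fc n f Hf).
    (* The number of a coordinate is some [n] with the function in [F n]. The default matters only
       for functions in no family; these are two-valued, hence never exceptional. *)
    + exists (fun g => epsilon (inhabits O) (fun n => F n (proj1_sig g))).
      assert (Hn : forall g, e x g <> 0 /\ e x g <> 1 ->
        F (epsilon (inhabits O) (fun n => F n (proj1_sig g))) (proj1_sig g)).
      { intros g [g0 g1]. apply epsilon_spec.
        destruct (proj2_sig g) as [[_ Hg] | Hg]; auto.
        now destruct (Hg x). }
      intros g h Hg Hh E. pose proof (Hn g Hg) as Fg. pose proof (Hn h Hh) as Fh.
      rewrite E in Fg. pose proof (Fd _ _ _ x Fg Fh Hg Hh) as Egh.
      destruct g as [g Pg], h as [h Ph]. simpl in Egh. subst h. f_equal. apply proof_irrelevance.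
  - now apply continuous_coordinates_open.
  - now apply compact_embedding.
Qed.

End LinearOrder.

(** * Families at all scales and separation of points *)

Theorem theorem1 (K : Type) (lt : K -> K -> Prop)
  (Hlin : strict_linear_order lt)
  (Hcomp : compact_space (order_open lt))
  (Hfrag : fragmentable (order_open lt)) :
  almost_totally_disconnected (order_open lt).
Proof.
  destruct Hfrag as (d & (dpos & _ & d0) & Hfr).
  pose (C (f h : K -> R) := forall z, ~ (in_between (f z) /\ in_between (h z))).
  destruct (choice (fun n F => (forall f, F f -> small_step K lt d (/ INR (S n)) f) /\
      (forall f h, F f -> F h -> f <> h -> C f h) /\
      (forall f, small_step K lt d (/ INR (S n)) f -> F f \/ exists h, F h /\ ~ C h f))) as [F HF].
  { intros n. apply maximal_compatible_family. intros f h H z [? ?]. now apply (H z). }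
  apply (disjoint_families_embed K lt Hlin F Hcomp).
  - intros n f Hf. destruct (proj1 (HF n) f Hf) as (? & ? & _). auto.
  - intros n f h x Hf Hh fx hx. apply NNPP. intros Hne.
    now apply (proj1 (proj2 (HF n)) f h Hf Hh Hne x).
  - intros x y xy. destruct (classic (dense_between K lt x y)) as [D | nD].
    + destruct (dense_between_four K lt Hlin x y xy D) as (u & u' & v & v' & H1 & H2 & H3 & H4 & H5).
      assert (dlt : forall s t, lt s t -> 0 < d s t).
      { intros s t st. destruct (dpos s t) as [H | H]; auto.
        symmetry in H. apply d0 in H. subst t. now destruct (lt_irr K lt Hlin s). }
      (* The scale must be below both distances, which are positive because distinct points have
         nonzero distance. *)
      destruct (archimed_cor1 (Rmin (d u u') (d v v'))) as (n & Hn & n0).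
      { apply Rmin_glb_lt; auto. }
      destruct n as [| n]; [lia |].
      pose proof (Rmin_l (d u u') (d v v')). pose proof (Rmin_r (d u u') (d v v')).
      destruct (maximal_family_separates K lt Hlin d (/ INR (S n)) (F n) x u u' v v' y)
        as (f & Ff & Hf); auto; try lra; try apply HF.
      { apply Rinv_0_lt_compat, lt_0_INR. lia. }
      exists f. split; auto. right. now exists n.
    (* A jump between [x] and [y] separates them by a two-valued coordinate. *)
    + destruct (not_dense_jump K lt x y nD) as (p & q & xp & qy & pq & J).
      destruct (jump_indicator K lt Hlin p q pq J) as (f & fc & f2 & f0 & f1).
      exists f. split; [| now left].
      rewrite f0, f1 by auto. lra.
Qed.
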